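(* For $i=1,2$ let $\mathcal{X}_i$ be a real Banach space, $\mathcal{C}_i\subset\mathcal{X}_i$ a closed pointed convex normal cone with nonempty interior $\mathcal{C}_i^0$, and $\mathbf{e}_i\in\mathcal{C}_i^0$. Let $T:\mathcal{X}_1\to\mathcal{X}_2$ be a bounded linear map such that $T(\mathbf{e}_1)\in\mathbb{R}\,\mathbf{e}_2$, with adjoint $T^\star$. Then $$\sup_{\substack{z\in\mathcal{X}_1\\ \omega(z/\mathbf{e}_1)\neq 0}}\frac{\omega(T(z)/\mathbf{e}_2)}{\omega(z/\mathbf{e}_1)}=\frac12\sup_{\substack{\nu,\pi\in\operatorname{extr}\mathcal{P}(\mathbf{e}_2)\\ \nu\perp\pi}}\|T^\star(\nu)-T^\star(\pi)\|_T^\star=\sup_{\substack{\nu,\pi\in\operatorname{extr}\mathcal{P}(\mathbf{e}_2)\\ \nu\perp\pi}}\ \sup_{x\in[0,\mathbf{e}_1]}\langle\nu-\pi,T(x)\rangle .$$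
   Context: A cone $\mathcal{C}$ in a real Banach space $(\mathcal{X},\|\cdot\|)$ is closed pointed convex if it is closed, $\alpha\mathcal{C}\subset\mathcal{C}$ for $\alpha\ge0$, $\mathcal{C}+\mathcal{C}\subset\mathcal{C}$, $\mathcal{C}\cap(-\mathcal{C})=\{0\}$; it is normal if there is $K>0$ with $0\le x\le y\Rightarrow\|x\|\le K\|y\|$, where $x\le y$ means $y-x\in\mathcal{C}$. Order interval: $[x,y]=\{z: x\le z\le y\}$. For $x\in\mathcal{X}$, $y\in\mathcal{C}^0$: $M(x/y)=\inf\{t\in\mathbb{R}: x\le ty\}$, $m(x/y)=\sup\{t\in\mathbb{R}: x\ge ty\}$, $\omega(x/y)=M(x/y)-m(x/y)$ (Hopf's oscillation). Dual cone: $\mathcal{C}^\star=\{\mu\in\mathcal{X}^\star:\langle\mu,x\rangle\ge0\ \forall x\in\mathcal{C}\}$; it induces the order on $\mathcal{X}^\star$ ($\mu\ge\mu'$ iff $\mu-\mu'\in\mathcal{C}^\star$). For $\mathbf{e}\in\mathcal{C}^0$, $\mathcal{P}(\mathbf{e})=\{\mu\in\mathcal{C}^\star:\langle\mu,\mathbf{e}\rangle=1\}$, and $\operatorname{extr}$ denotes the set of extreme points. For $\nu,\pi\in\mathcal{P}(\mathbf{e})$, $\nu\perp\pi$ (disjoint) means: every $\mu\in\mathcal{P}(\mathbf{e})$ with $\mu\ge\nu/2$ and $\mu\ge\pi/2$ equals $(\nu+\pi)/2$. Thompson's norm on $\mathcal{X}_1$ is $\|z\|_T=\inf\{\alpha>0:-\alpha\mathbf{e}_1\le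 z\le\alpha\mathbf{e}_1\}$, and $\|\cdot\|_T^\star$ is its dual norm on $\mathcal{X}_1^\star$. The first supremum is interpreted as $0$ if it is over the empty set (i.e. if $\dim\mathcal{X}_1=1$). *)

(* Defs.v *)
From mathcomp Require Import all_boot all_order all_algebra.
From mathcomp Require Import all_classical all_reals all_analysis.

Set Implicit Arguments.
Unset Strict Implicit.
Unset Printing Implicit Defensive.

Import Order.TTheory GRing.Theory Num.Theory.
Import numFieldNormedType.Exports.

Local Open Scope classical_set_scope.
Local Open Scope ring_scope.

Section OrderedSpaces.
Variables (R : realType) (V : lmodType R).
Implicit Types (C A : set V) (x y z : V).

(* x <= y in the order induced by C; also used with C a dual cone. *)
Definition cone_le C x y : Prop := C (y - x).

Definition order_interval C x y : set V :=
  [set z | cone_le C x z /\ cone_le C z y].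

(* M(x/y), m(x/y) and omega(x/y): real-valued, as y is meant to be interior to
   C; inf and sup only take their default value 0 when y = 0 (zero space). *)
Definition Mratio C x y : R := inf [set t : R | cone_le C x (t *: y)].

Definition mratio C x y : R := sup [set t : R | cone_le C (t *: y) x].

Definition hopf_osc C x y : R := Mratio C x y - mratio C x y.

Definition thompson_norm C (e z : V) : R :=
  inf [set a : R | [/\ 0 < a, cone_le C (- (a *: e)) z & cone_le C z (a *: e)]].

Definition extr A : set V :=
  [set x | A x /\ forall (y z : V) (t : R), A y -> A z -> 0 < t < 1 ->
     x = t *: y + (1 - t) *: z -> y = x /\ z = x].

End OrderedSpaces.

Section BanachCones.
Variables (R : realType) (X : normedModType R).
Implicit Types (C : set X) (e : X).

Definition closed_pointed_convex_cone C : Prop :=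
  [/\ closed C,
      forall (a : R) (x : X), 0 <= a -> C x -> C (a *: x),
      forall x y : X, C x -> C y -> C (x + y)
    & C `&` (-%R @` C) = [set 0]].

Definition normal_cone C : Prop :=
  exists2 K : R, 0 < K & forall x y : X,
    cone_le C 0 x -> cone_le C x y -> `|x| <= K * `|y|.

(* The topological dual, as a subset of the R-module of all functions X -> R
   (with pointwise operations). *)
Definition dual_space : set (X -> R^o) := [set f | linear f /\ continuous f].

Definition dual_cone C : set (X -> R^o) :=
  [set mu | dual_space mu /\ forall x, C x -> 0 <= mu x].

Definition normalized C e : set (X -> R^o) :=
  [set mu | dual_cone C mu /\ mu e = 1].

Definition disjoint_functionals C e (nu pi : X -> R^o) : Prop :=
  forall mu, normalized C e mu ->
    cone_le (dual_cone C) (2^-1 *: nu) mu ->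
    cone_le (dual_cone C) (2^-1 *: pi) mu ->
    mu = 2^-1 *: (nu + pi).

Definition thompson_dual_norm C e (f : X -> R^o) : \bar R :=
  ereal_sup [set (`|f z|)%:E | z in [set z | thompson_norm C e z <= 1]].

End BanachCones.

Section AdjointAndSup.
Variable R : realType.

Definition adjoint (X Y : normedModType R) (T : X -> Y) (f : Y -> R^o) :
  X -> R^o := f \o T.

(* Supremum with the convention that the empty supremum is 0. *)
Definition sup_or0 (A : set \bar R) : \bar R :=
  if `[< A !=set0 >] then ereal_sup A else 0%E.

End AdjointAndSup.

(* Main.v *)
Require Import Defs.
From HB Require Import structures.
From mathcomp Require Import all_boot all_order all_algebra.
From mathcomp Require Import all_classical all_reals all_analysis.
From mathcomp Require Import ring lra.

Import Order.TTheory GRing.Theory Num.Theory.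
Import numFieldNormedType.Exports.

Local Open Scope classical_set_scope.
Local Open Scope ring_scope.

(** The heart of the matter is a dual description of the oscillation on the
target space: for each [y], [hopf_osc C2 y e2] is the maximum of [nu y - pi y]
over the disjoint pairs [nu], [pi] of extreme points of [normalized C2 e2]
([hopf_osc_attained]).

Write [M] for the sublinear functional [x |-> Mratio C x e]. A linear form is a
normalized positive functional exactly when it lies below [M]
([normalizedE]), and [hopf_osc C x e = M x + M (- x)]. Hence [nu - pi] lies
below the oscillation for all normalized [nu] and [pi]; conversely a
Hahn-Banach separation shows that every linear form below the oscillation is
such a difference ([dominated_osc_diff]). Suppose now that [nu - pi] is an
extreme point of this set of differences. Writing [nu] or [pi] as a proper
convex combination would decompose [nu - pi], so both are extreme. If moreover
[mu] is normalized, [mu >= nu / 2] and [mu >= pi / 2], then [2 mu - nu] and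
[2 mu - pi] are normalized and
[nu - pi = ((nu - (2 mu - nu)) + ((2 mu - pi) - pi)) / 2],
so that [nu - (2 mu - nu) = nu - pi] by extremality, i.e.
[mu = (nu + pi) / 2]: the pair is disjoint.

It remains to find, among the linear forms below a sublinear [p], an extreme
one whose value at [y] is [p y] ([extreme_hahn_banach]). Instead of weak-star
compactness and the Krein-Milman theorem, the proof applies Zorn's lemma to the
sublinear functionals [q <= p] that cut out a face of the set of linear forms
below [p]. Fixing the value of the forms at one more point to its maximum
replaces [q] by a smaller functional of this kind, so a minimal one is linear,
and a one-point face is an extreme point.

The theorem then follows by rescaling. When its oscillation is nonzero, [z] is
[hopf_osc C1 z e1 *: x + m *: e1] with [x] in the order interval [[0, e1]]
([rescale_to_interval]); elements of the interval have oscillation at most 1;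
and [(nu - pi) \o T] vanishes at [e1]. So the oscillation ratio and the
supremum over the interval bound each other. Finally, the affine map
[x |-> 2 x - e1] takes the interval onto the unit ball of Thompson's norm, which
accounts for the factor one half. *)

(** * Linear forms and sublinear functionals *)

Section LinearFunctionals.
Context {R : realType} {V : lmodType R}.
Implicit Types (f g : V -> R^o) (x y : V).

Lemma linear_fctD f : linear f -> forall x y, f (x + y) = f x + f y.
Proof. by move=> fl x y; have := fl 1 x y; rewrite !scale1r. Qed.

Lemma linear_fct0 f : linear f -> f 0 = 0.
Proof.
by move=> fl; have := linear_fctD f fl 0 0; rewrite addr0; lra.
Qed.

Lemma linear_fctZ f : linear f -> forall a x, f (a *: x) = a * f x.
Proof.
by move=> fl a x; have := fl a x 0; rewrite !addr0 (linear_fct0 f fl) addr0.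
Qed.

Lemma linear_fctN f : linear f -> forall x, f (- x) = - f x.
Proof. by move=> fl x; rewrite -scaleN1r (linear_fctZ f fl) mulN1r. Qed.

Lemma linear_fctB f : linear f -> forall x y, f (x - y) = f x - f y.
Proof. by move=> fl x y; rewrite (linear_fctD f fl) (linear_fctN f fl). Qed.

Lemma linear_comb f g (a b : R) : linear f -> linear g ->
  linear (a *: f + b *: g : V -> R^o).
Proof.
move=> fl gl c x y; rewrite !fctE !(linear_fctD _ fl, linear_fctD _ gl).
by rewrite !(linear_fctZ _ fl, linear_fctZ _ gl) /GRing.scale /=; ring.
Qed.

End LinearFunctionals.

Section Sublinear.
Context {R : realType} {V : lmodType R}.
Implicit Types (p q : V -> R) (f g : V -> R^o) (x y : V) (K : set (V * R)).

Definition sublinear p : Prop :=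
  (forall x y, p (x + y) <= p x + p y) /\
  (forall (a : R) x, 0 < a -> p (a *: x) <= a * p x).

Definition dominated p : set (V -> R^o) :=
  [set f : V -> R^o | linear f /\ forall x, f x <= p x].

Lemma sublinear0 p : sublinear p -> p 0 = 0.
Proof.
move=> [_ pZ]; apply/eqP; rewrite eq_le; apply/andP; split.
  by have := pZ 2^-1 0; rewrite scaler0 => /(_ ltac:(lra)); lra.
by have := pZ 2 0; rewrite scaler0 => /(_ ltac:(lra)); lra.
Qed.

Lemma sublinearN p : sublinear p -> forall x, 0 <= p x + p (- x).
Proof. by move=> ps x; rewrite -(sublinear0 p ps) -(subrr x) ps.1. Qed.

Lemma sublinear_linear p : sublinear p -> (forall x, p x + p (- x) <= 0) ->
  linear (p : V -> R^o).
Proof.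
move=> ps pN.
have eN x : p (- x) = - p x by have := sublinearN p ps x; have := pN x; lra.
have pD x y : p (x + y) = p x + p y.
  apply/eqP; rewrite eq_le ps.1 /=.
  have := ps.1 (- x) (- y); rewrite -opprD !eN; lra.
have pZ a x : 0 < a -> p (a *: x) = a * p x.
  move=> a0; apply/eqP; rewrite eq_le ps.2 //=.
  have := ps.2 a (- x) a0; rewrite scalerN !eN; lra.
move=> a x y; rewrite pD; congr (_ + _); change (p (a *: x) = a * p x).
have [a0|a0|->] := ltgtP a 0; last by rewrite scale0r sublinear0// mul0r.
- by rewrite -[a *: x]opprK -scaleNr eN pZ ?oppr_gt0// mulNr opprK.
- exact: pZ.
Qed.

(** The largest sublinear functional below [q] whose value at [v] is at most
[r] for each [(v, r)] in [K], provided [K] is a convex cone compatible with [q];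
this is the construction behind the Mazur-Orlicz theorem. It serves both to fix
the value of linear forms at a point and to separate in the
decomposition of [dominated_osc_diff]. *)
Definition constrain q K x : R := inf [set q (x - k.1) + k.2 | k in K].

(** The last clause keeps the infimum in [constrain] finite: subadditivity turns
it into the lower bound [- q (- x)]. *)
Definition compatible q K : Prop :=
  [/\ K (0, 0), forall k l, K k -> K l -> K (k.1 + l.1, k.2 + l.2),
      forall (a : R) k, 0 < a -> K k -> K (a *: k.1, a * k.2)
    & forall k, K k -> 0 <= q (- k.1) + k.2].

Section Constrain.
Variables (q : V -> R) (K : set (V * R)).
Hypotheses (qs : sublinear q) (qK : compatible q K).

Lemma constrain_le x k : K k -> constrain q K x <= q (x - k.1) + k.2.
Proof.
move=> Kk; apply: ge_inf; last by exists k.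
exists (- q (- x)) => _ [l Kl <-].
have [_ _ _ /(_ l Kl)] := qK.
have := qs.1 (x - l.1) (- x); rewrite addrAC subrr add0r; lra.
Qed.

Lemma le_constrain x (a : R) :
  (forall k, K k -> a <= q (x - k.1) + k.2) -> a <= constrain q K x.
Proof.
move=> aK; apply: lb_le_inf; last by move=> _ [k Kk <-]; exact: aK.
have [K0 _ _ _] := qK; exact: image_nonempty (ex_intro _ _ K0).
Qed.

Lemma constrain_le_self x : constrain q K x <= q x.
Proof.
have [K0 _ _ _] := qK.
by apply: le_trans (constrain_le x (0, 0) K0) _; rewrite subr0 addr0.
Qed.

Lemma constrain_sublinear : sublinear (constrain q K).
Proof.
have [_ KD KZ _] := qK; split=> [x y|a x a0].
  rewrite -lerBlDr; apply: le_constrain => k Kk.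
  rewrite lerBlDr -lerBlDl; apply: le_constrain => l Kl.
  have := constrain_le (x + y) _ (KD _ _ Kk Kl) => /=.
  have := qs.1 (x - k.1) (y - l.1); rewrite addrACA -opprD; lra.
rewrite -ler_pdivrMl//; apply: le_constrain => k Kk.
rewrite ler_pdivrMl//.
apply: le_trans (constrain_le _ _ (KZ a k a0 Kk)) _ => /=.
by rewrite mulrDr lerD2r -scalerBr qs.2.
Qed.

End Constrain.

(** Constraining by this ray requires the value at [- y] to be at most [- q y],
that is, the value at [y] to be the largest one allowed by [q]. *)
Definition ray q y : set (V * R) :=
  [set (- (t *: y), - (t * q y)) | t in [set t : R | 0 <= t]].

Lemma ray_compatible q y : sublinear q -> compatible q (ray q y).
Proof.
move=> qs; split.
- by exists 0 => //=; rewrite scale0r mul0r !oppr0.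
- move=> _ _ [t t0 <-] [s s0 <-]; exists (t + s); first exact: addr_ge0.
  by rewrite /= scalerDl mulrDl !opprD.
- move=> a _ a0 [t t0 <-]; exists (a * t); first by rewrite /= mulr_ge0// ltW.
  by rewrite /= -scalerA scalerN mulrN mulrA.
- move=> _ [t t0 <-] /=; rewrite opprK subr_ge0.
  move: t0; rewrite /= le_eqVlt => /predU1P[<-|t0].
    by rewrite mul0r scale0r sublinear0.
  have := qs.2 t^-1 (t *: y); rewrite invr_gt0 => /(_ t0).
  by rewrite scalerA mulVf ?gt_eqF// scale1r ler_pdivlMl.
Qed.

Lemma dominated_ray q y f : sublinear q ->
  dominated (constrain q (ray q y)) f <-> dominated q f /\ f y = q y.
Proof.
move=> qs; have qK := ray_compatible q y qs; split.
  move=> [fl fc]; have fq x : f x <= q x.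
    by apply: le_trans (fc x) (constrain_le_self q _ qs qK x).
  split=> //; apply/eqP; rewrite eq_le fq /=.
  have /(constrain_le _ _ qs qK (- y)) : ray q y (- (1 *: y), - (1 * q y)).
    by exists 1 => //=.
  rewrite /= scale1r mul1r opprK addNr sublinear0//.
  by have := fc (- y); rewrite linear_fctN//; lra.
move=> [[fl fq] fy]; split=> // x.
apply: le_constrain qK _ _ _ => _ [t t0 <-] /=; rewrite opprK.
by have := fq (x + t *: y); rewrite linear_fctD// linear_fctZ// fy; lra.
Qed.

(** A closed face of [dominated p] is encoded by its support functional [q]; a
decreasing family of faces then has the pointwise infimum of the support
functionals as its lower bound. *)
Definition face p q : Prop :=
  [/\ sublinear q, forall x, q x <= p x
    & forall f g (t : R), dominated p f -> dominated p g -> 0 < t < 1 ->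
        dominated q (t *: f + (1 - t) *: g) -> dominated q f /\ dominated q g].

Lemma face_refl p : sublinear p -> face p p.
Proof. by []. Qed.

Lemma convex_eq_bound (a b c t : R) : 0 < t < 1 -> a <= c -> b <= c ->
  t * a + (1 - t) * b = c -> a = c /\ b = c.
Proof.
move=> /andP[t0 t1] ac bc h; split; apply/eqP; rewrite eq_le ?ac ?bc /=; nra.
Qed.

(** The linear forms maximizing evaluation at [y] form a face of a face. *)
Lemma face_ray p q y : face p q -> face p (constrain q (ray q y)).
Proof.
move=> [qs qp qf]; have qK := ray_compatible q y qs; split.
- exact: constrain_sublinear.
- by move=> x; apply: le_trans (qp x); exact: constrain_le_self.
move=> f g t fp gp t01 /dominated_ray -/(_ qs) [hq hy].
have [fq gq] := qf f g t fp gp t01 hq.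
have [fy gy] := convex_eq_bound _ _ _ _ t01 (fq.2 y) (gq.2 y) hy.
by split; apply/dominated_ray.
Qed.

(** Totality of the family is what makes the infimum subadditive: the smaller of
two members bounds both terms at once. *)
Lemma face_inf p (A : set (V -> R)) : sublinear p -> A !=set0 ->
  (forall q, A q -> face p q) ->
  total_on A (fun q r => forall x, r x <= q x) ->
  face p (fun x => inf [set q x | q in A]).
Proof.
move=> ps A0 Af Atot.
have lb x q : A q -> inf [set q x | q in A] <= q x.
  move=> Aq; apply: ge_inf; last by exists q.
  exists (- p (- x)) => _ [r Ar <-]; have [rs rp _] := Af r Ar.
  by have := sublinearN r rs x; have := rp (- x); lra.
have glb x (a : R) : (forall q, A q -> a <= q x) -> a <= inf [set q x | q in A].
  move=> h; apply: lb_le_inf; first exact: image_nonempty.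
  by move=> _ [q Aq <-]; exact: h.
have [q0 Aq0] := A0.
split.
- split=> [x y|a x a0].
    rewrite -lerBlDr; apply: (glb) => q Aq; rewrite lerBlDr -lerBlDl.
    apply: (glb) => r Ar; rewrite lerBlDl.
    have [[qs _ _] [rs _ _]] := (Af _ Aq, Af _ Ar).
    case: (Atot q r Aq Ar) => le.
      apply: le_trans (lb _ _ Ar) _; apply: le_trans (rs.1 _ _) _.
      by rewrite lerD2r.
    apply: le_trans (lb _ _ Aq) _; apply: le_trans (qs.1 _ _) _.
    by rewrite lerD2l.
  rewrite -ler_pdivrMl//; apply: (glb) => q Aq; rewrite ler_pdivrMl//.
  by apply: le_trans (lb _ _ Aq) _; have [qs _ _] := Af q Aq; exact: qs.2.
- by move=> x; apply: le_trans (lb x q0 Aq0) _; have [_ + _] := Af q0 Aq0.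
move=> f g t fp gp t01 [hl hq].
suff fg q : A q -> dominated q f /\ dominated q g.
  split; (split; first by case: fp gp => ? _ [? _]).
  - by move=> x; apply: (glb) => q /fg[[]].
  - by move=> x; apply: (glb) => q /fg[_ []].
move=> Aq; have [_ _ qf] := Af q Aq; apply: (qf f g t) => //.
by split=> // x; apply: le_trans (hq x) (lb x q Aq).
Qed.

(** A minimal face is left unchanged when the value at any [y] is fixed to
its maximum [q y]; then [q (- y) <= - q y] for all [y], so that [q] is linear
and is the only linear form in the face. *)
Lemma exists_extr_dominated p : sublinear p -> exists f, extr (dominated p) f.
Proof.
move=> ps.
pose T := {q : V -> R | face p q}.
pose below (q r : T) : bool := `[< forall x, sval r x <= sval q x >].
have [||A Atot|[q qf] qmin] :=
    @ZL_preorder T (exist _ p (face_refl p ps)) below.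
- by move=> q; apply/asboolP.
- move=> r q s /asboolP qr /asboolP rs; apply/asboolP => x.
  exact: le_trans (rs x) (qr x).
- have [[q0 Aq0]|A0] := pselect (A !=set0); last first.
    exists (exist _ p (face_refl p ps)) => q Aq; case: A0.
    by exists q.
  pose B := [set sval q | q in A].
  have BF : face p (fun x => inf [set q x | q in B]).
    apply: face_inf => //.
    + by exists (sval q0); exists q0.
    + by move=> _ [q _ <-]; exact: svalP q.
    + move=> _ _ [q Aq <-] [r Ar <-].
      by case: (Atot q r Aq Ar) => /asboolP; [left|right].
  exists (exist _ _ BF) => q Aq; apply/asboolP => x /=.
  apply: ge_inf; last by exists (sval q) => //; exists q.
  exists (- p (- x)) => _ [_ [r _ <-] <-].
  have [rs rp _] := svalP r.
  by have := sublinearN _ rs x; have := rp (- x); lra.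
have [qs qp qface] := qf.
have ql : linear (q : V -> R^o).
  apply: sublinear_linear => // y.
  have qK := ray_compatible q y qs.
  have /qmin /asboolP /(_ (- y)) /= le1 :
      below (exist _ q qf) (exist _ _ (face_ray p q y qf)).
    by apply/asboolP => x /=; exact: constrain_le_self.
  have /(constrain_le _ _ qs qK (- y)) : ray q y (- (1 *: y), - (1 * q y)).
    by exists 1 => //=.
  rewrite /= scale1r mul1r opprK addNr sublinear0//; lra.
exists q; split=> // f g t fp gp t01 qE.
have [|fq gq] := qface f g t fp gp t01; first by rewrite -qE.
have eq_lin h : dominated q h -> h = q.
  move=> [hl hq]; apply/funext => x; apply/eqP; rewrite eq_le hq /=.
  by have := hq (- x); rewrite linear_fctN// (linear_fctN _ ql) lerN2.
by split; exact: eq_lin.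
Qed.

(** Hahn-Banach theorem with an extreme extension: an extreme point of the face
on which evaluation at [y] is maximal is extreme in the whole set. *)
Theorem extreme_hahn_banach p y : sublinear p ->
  exists2 f, extr (dominated p) f & f y = p y.
Proof.
move=> ps; have qK := ray_compatible p y ps.
have [f [fd fextr]] := exists_extr_dominated _ (constrain_sublinear p _ ps qK).
have [fp fy] := (dominated_ray p y f ps).1 fd.
exists f => //; split=> // g h t gp hp t01 fE.
have [gy hy] : g y = p y /\ h y = p y.
  by apply: (convex_eq_bound _ _ _ t) (gp.2 y) (hp.2 y) _ => //; rewrite -fy fE.
by apply: (fextr g h t) => //; apply/dominated_ray.
Qed.

End Sublinear.

(** * Order units and Hopf's oscillation *)

Section Cone.
Context {R : realType} {X : normedModType R} {C : set X} {e : X}.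
Hypotheses (hC : closed_pointed_convex_cone C) (he : C° e).
Implicit Types (x y : X) (f nu pi mu : X -> R^o).

Lemma coneD x y : C x -> C y -> C (x + y).
Proof. by have [_ _ + _] := hC; exact. Qed.

Lemma coneZ (a : R) x : 0 <= a -> C x -> C (a *: x).
Proof. by have [_ + _ _] := hC; exact. Qed.

Lemma cone_pointed x : C x -> C (- x) -> x = 0.
Proof.
move=> Cx CNx; have [_ _ _ C0] := hC.
have : (C `&` (-%R @` C)) x by split=> //; exists (- x) => //; rewrite opprK.
by rewrite C0.
Qed.

(** A ball of radius [d] around [e] inside the cone gives the constant [2 / d];
any constant larger than [1 / d] would do. *)
Lemma interior_order_unit :
  exists2 k : R, 0 < k & forall x, C ((k * `|x|) *: e - x).
Proof.
have /nbhs_ballP[d /= d0 dC] := he.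
have Ce : C e by apply: dC; exact: ballxx.
exists (2 / d); first by rewrite divr_gt0.
move=> x; have [->|x0] := eqVneq x 0.
  rewrite normr0 mulr0 scale0r subr0.
  by have := coneZ 0 _ (lexx _) Ce; rewrite scale0r.
have nx0 : 0 < `|x| by rewrite normr_gt0.
have a0 : 0 < 2 / d * `|x| by rewrite mulr_gt0// divr_gt0.
have -> : (2 / d * `|x|) *: e - x =
    (2 / d * `|x|) *: (e - (2 / d * `|x|)^-1 *: x).
  by rewrite scalerBr scalerA mulfV ?gt_eqF// scale1r.
apply: coneZ; first exact: ltW.
apply: dC; rewrite -ball_normE /= opprB addrC subrK normrZ gtr0_norm ?invr_gt0//.
rewrite invfM -mulrA mulVf ?gt_eqF// mulr1 invfM invrK.
lra.
Qed.

Lemma cone_unit : C e.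
Proof. exact: interior_subset he. Qed.

Lemma cone0 : C 0.
Proof. by have := coneZ 0 _ (lexx _) cone_unit; rewrite scale0r. Qed.

(** In a nonzero space a pointed cone cannot have 0 in its interior. *)
Lemma unit_neq0 x : x != 0 -> e != 0.
Proof.
have [k _ ke] := interior_order_unit; apply: contraNneq => e0.
have := ke x; have := ke (- x); rewrite e0 !scaler0 !sub0r opprK => Cx CNx.
by rewrite (cone_pointed x).
Qed.

Hypothesis e_neq0 : e != 0.

Local Notation M x := (Mratio C x e).

Lemma cone_scale_unit (t : R) : C (t *: e) -> 0 <= t.
Proof.
move=> Cte; rewrite leNgt; apply/negP => t0.
case/eqP: e_neq0; apply: (cone_pointed e cone_unit).
have : C ((- t)^-1 *: (t *: e)) by apply: coneZ => //; rewrite invr_ge0; lra.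
by rewrite scalerA invrN mulNr mulVf ?lt_eqF// scaleN1r.
Qed.

(** Adding [x <= t e] and [- x <= k |x| e] gives [0 <= (t + k |x|) e], and a
nonnegative multiple of [e] has a nonnegative coefficient. *)
Lemma Mratio_has_lbound x : has_lbound [set t : R | cone_le C x (t *: e)].
Proof.
have [k _ ke] := interior_order_unit.
exists (- (k * `|x|)) => t /= Ct.
have := coneD _ _ Ct (ke (- x)); rewrite normrN opprK addrACA addNr addr0.
rewrite -scalerDl => /cone_scale_unit; lra.
Qed.

Lemma Mratio_le x (t : R) : C (t *: e - x) -> M x <= t.
Proof. by move=> Ct; apply: ge_inf => //; exact: Mratio_has_lbound. Qed.

(** The cone is closed, so the infimum defining [Mratio] is a minimum. *)
Lemma Mratio_attained x : C (M x *: e - x).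
Proof.
have [k k0 ke] := interior_order_unit.
apply: contrapT => nC; have [Ccl _ _ _] := hC.
have /nbhs_ballP[d /= d0 dC] : nbhs (M x *: e - x) (~` C).
  by apply: open_nbhs_nbhs; split => //; exact: closed_openC.
have ne0 : 0 < `|e| by rewrite normr_gt0.
have [t Ct tM] : exists2 t, C (t *: e - x) & t < M x + d / `|e|.
  apply: inf_adherent; first by rewrite divr_gt0.
  split; last exact: Mratio_has_lbound.
  by exists (k * `|x|); exact: ke.
apply: (dC (t *: e - x)) => //.
rewrite -ball_normE /= opprB addrA subrK -scalerBl normrZ distrC.
rewrite ger0_norm; last by have := Mratio_le x t Ct; lra.
by rewrite -ltr_pdivlMr//; lra.
Qed.

Lemma Mratio_sublinear : sublinear (fun x => M x).
Proof.
split=> [x y|a x a0]; apply: Mratio_le.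
  rewrite scalerDl opprD addrACA.
  exact: coneD (Mratio_attained _) (Mratio_attained _).
by rewrite -scalerA -scalerBr; apply: coneZ (Mratio_attained _); exact: ltW.
Qed.

Lemma hopf_oscE x : hopf_osc C x e = M x + M (- x).
Proof.
rewrite /hopf_osc /mratio /Mratio /inf; congr (_ - sup _).
apply/seteqP; split=> t /=; rewrite /cone_le.
  move=> Ct; exists (- t); last exact: opprK.
  by rewrite scaleNr opprK addrC.
by move=> [s Cs <-]; move: Cs; rewrite scaleNr !opprK addrC.
Qed.

Lemma hopf_osc_sublinear : sublinear (fun x => hopf_osc C x e).
Proof.
have [MD MZ] := Mratio_sublinear; split=> [x y|a x a0]; rewrite !hopf_oscE.
  by have := MD x y; have := MD (- x) (- y); rewrite -opprD; lra.
by have := MZ a x a0; have := MZ a (- x) a0; rewrite scalerN; lra.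
Qed.

(** Positivity forces continuity, since the cone has an interior point. *)
Lemma positive_normalized mu : linear mu -> (forall x, C x -> 0 <= mu x) ->
  mu e = 1 -> normalized C e mu.
Proof.
move=> mul mu0 mue; split=> //; split=> //; split=> //.
have [k k0 ke] := interior_order_unit.
pose mu' : {linear X -> R^o} :=
  HB.pack mu (GRing.isLinear.Build _ _ _ _ mu mul).
apply: (@bounded_linear_continuous _ _ _ mu').
have mu_le x : mu x <= k * `|x|.
  have := mu0 _ (ke x); rewrite (linear_fctB _ mul) (linear_fctZ _ mul) mue; lra.
exists k; split; first exact: num_real.
move=> B kB; near=> x => /=.
have x1 : `|x| <= 1 by near: x; exact: nbhs0_le.
apply: (@le_trans _ _ (k * `|x|)); last by nra.
rewrite ler_norml mu_le andbT.
by have := mu_le (- x); rewrite normrN (linear_fctN _ mul); lra.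
Unshelve. all: by end_near. Qed.

(** Positivity is being below [M] on the opposite of the cone, and
normalization comes from [M e <= 1] and [M (- e) <= -1]. *)
Lemma normalizedE : normalized C e = dominated (fun x => M x).
Proof.
apply/seteqP; split=> mu.
  move=> [[[mul muc] mu0] mue]; split=> // x.
  have := mu0 _ (Mratio_attained x).
  by rewrite (linear_fctB _ mul) (linear_fctZ _ mul) mue; lra.
move=> [mul muM]; apply: positive_normalized => //.
  move=> x Cx; have : M (- x) <= 0.
    by apply: Mratio_le; rewrite scale0r sub0r opprK.
  by have := muM (- x); rewrite (linear_fctN _ mul); lra.
have : M e <= 1 by apply: Mratio_le; rewrite scale1r subrr; exact: cone0.
have : M (- e) <= -1.
  by apply: Mratio_le; rewrite scaleN1r subrr; exact: cone0.
have := muM e; have := muM (- e); rewrite (linear_fctN _ mul); lra.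
Qed.

Lemma normalized_diff_le_osc nu pi x : normalized C e nu -> normalized C e pi ->
  nu x - pi x <= hopf_osc C x e.
Proof.
rewrite normalizedE hopf_oscE => -[_ nuM] [pil piM].
by have := nuM x; have := piM (- x); rewrite (linear_fctN _ pil); lra.
Qed.

(** The form [nu] has to satisfy [nu <= M] and [nu - f <= M], i.e. to lie below
both [M] and [M + f]. The two can be separated because
[- f (- x) <= M x + M (- x)]. *)
Lemma dominated_osc_diff f : dominated (fun x => hopf_osc C x e) f ->
  exists nu pi, [/\ normalized C e nu, normalized C e pi & f = nu - pi].
Proof.
move=> [fl fosc]; have Ms := Mratio_sublinear.
(* the graph of [M + f] is not closed under addition, its epigraph is *)
pose K : set (X * R) := [set k | M k.1 + f k.1 <= k.2].
have KM : compatible (fun x => M x) K.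
  split.
  - by rewrite /K /= (linear_fct0 _ fl) (sublinear0 _ Ms) addr0.
  - move=> k l; rewrite /K /= (linear_fctD _ fl) => Kk Kl.
    by have := Ms.1 k.1 l.1; lra.
  - move=> a k a0; rewrite /K /= (linear_fctZ _ fl) => Kk.
    have := Ms.2 a k.1 a0; rewrite -(ler_pM2l a0) in Kk; lra.
  - move=> k; rewrite /K /= => Kk.
    by have := fosc (- k.1); rewrite hopf_oscE opprK (linear_fctN _ fl); lra.
have [nu [[nul nuK] _] _] :=
  extreme_hahn_banach _ 0 (constrain_sublinear _ _ Ms KM).
have nuM x : nu x <= M x.
  exact: le_trans (nuK x) (constrain_le_self _ _ Ms KM x).
have piM x : nu x - f x <= M x.
  rewrite lerBlDr; apply: le_trans (nuK x) _.
  have := constrain_le _ _ Ms KM x (x, M x + f x) (lexx _).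
  by rewrite /= subrr (sublinear0 _ Ms) add0r.
exists nu, (nu - f); rewrite normalizedE; split=> //.
- split=> [|x]; last exact: piM.
  by have := linear_comb nu f 1 (-1) nul fl; rewrite scale1r scaleN1r.
- by rewrite opprB addrC subrK.
Qed.

Lemma diff_dominated_osc nu pi : normalized C e nu -> normalized C e pi ->
  dominated (fun x => hopf_osc C x e) (nu - pi).
Proof.
move=> hnu hpi; split=> [|x]; last exact: normalized_diff_le_osc.
have [[[nul _] _] _] := hnu; have [[[pil _] _] _] := hpi.
by have := linear_comb nu pi 1 (-1) nul pil; rewrite scale1r scaleN1r.
Qed.

Section ExtremeDifference.
Variables nu pi : X -> R^o.
Hypotheses (hnu : normalized C e nu) (hpi : normalized C e pi).
Hypothesis extr_diff : extr (dominated (fun x => hopf_osc C x e)) (nu - pi).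

Lemma extr_diff_left : extr (normalized C e) nu.
Proof.
split=> // f g t hf hg t01 nuE; have [_ ex] := extr_diff.
have [|h1 h2] := ex (f - pi) (g - pi) t (diff_dominated_osc _ _ hf hpi)
  (diff_dominated_osc _ _ hg hpi) t01.
  by rewrite nuE !scalerBr addrACA -opprD -scalerDl [t + _]addrC subrK scale1r.
by split; apply: (addIr (- pi)).
Qed.

Lemma extr_diff_right : extr (normalized C e) pi.
Proof.
split=> // f g t hf hg t01 piE; have [_ ex] := extr_diff.
have [|h1 h2] := ex (nu - f) (nu - g) t (diff_dominated_osc _ _ hnu hf)
  (diff_dominated_osc _ _ hnu hg) t01.
  by rewrite piE !scalerBr addrACA -opprD -scalerDl [t + _]addrC subrK scale1r.
by split; apply/oppr_inj/(addrI nu).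
Qed.

Lemma complement_normalized (rho mu : X -> R^o) :
  normalized C e rho -> normalized C e mu ->
  cone_le (dual_cone C) (2^-1 *: rho) mu -> normalized C e (2 *: mu - rho).
Proof.
move=> [[[rhol _] _] rhoe] [[[mul _] _] mue] [_ ge0].
apply: positive_normalized.
- by have := linear_comb mu rho 2 (-1) mul rhol; rewrite scaleN1r.
- move=> x /ge0; rewrite !fctE /GRing.scale /=; lra.
- by rewrite !fctE mue rhoe /GRing.scale /=; lra.
Qed.

Lemma extr_diff_disjoint : disjoint_functionals C e nu pi.
Proof.
move=> mu hmu nule pile; have [_ ex] := extr_diff.
have hs := complement_normalized _ _ hnu hmu nule.
have hr := complement_normalized _ _ hpi hmu pile.
(* [nu - pi] is the midpoint of [nu - sigma] and [rho - pi], where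
   [sigma = 2 mu - nu] and [rho = 2 mu - pi] *)
have [||h _] := ex (nu - (2 *: mu - nu)) ((2 *: mu - pi) - pi) 2^-1
  (diff_dominated_osc _ _ hnu hs) (diff_dominated_osc _ _ hr hpi).
- lra.
- apply/funext => x; rewrite !fctE /GRing.scale /=; lra.
apply/funext => x; have := congr1 (fun f => f x) h.
rewrite !fctE /GRing.scale /=; lra.
Qed.

End ExtremeDifference.

(** The oscillation is the support functional of the set of differences of
normalized functionals; the maximum is reached at an extreme difference, whose
two terms are extreme and disjoint. *)
Theorem hopf_osc_attained y : exists nu pi,
  [/\ extr (normalized C e) nu, extr (normalized C e) pi,
      disjoint_functionals C e nu pi & nu y - pi y = hopf_osc C y e].
Proof.
have [f fex fy] := extreme_hahn_banach _ y hopf_osc_sublinear.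
have [nu [pi [hnu hpi fE]]] := dominated_osc_diff f fex.1.
rewrite fE in fex fy; exists nu, pi; split => //.
- exact: (extr_diff_left _ pi).
- exact: (extr_diff_right nu).
- exact: extr_diff_disjoint.
Qed.

End Cone.

(** * The order interval, oscillation and Thompson's norm *)

Section OrderUnitInterval.
Context {R : realType} {X : normedModType R} {C : set X} {e : X}.
Hypotheses (hC : closed_pointed_convex_cone C) (he : C° e).
Implicit Types (x z : X) (g : X -> R^o).

Lemma unit_eq0 x : e = 0 -> x = 0.
Proof.
move=> e0; apply/eqP; apply: contraPT (e0) => /(unit_neq0 hC he) /eqP.
exact.
Qed.

(** If [e = 0] the space is zero and the infimum and supremum range over
all reals, hence take their default value 0. *)
Lemma hopf_osc_unit_eq0 x : e = 0 -> hopf_osc C x e = 0.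
Proof.
move=> e0; rewrite /hopf_osc /Mratio /mratio /cone_le (unit_eq0 x e0) e0.
have -> : [set t : R | C (t *: 0 - 0)] = setT.
  apply/seteqP; split=> // t _ /=; rewrite scaler0 subr0; exact: (cone0 hC he).
have -> : [set t : R | C (0 - t *: 0)] = setT.
  apply/seteqP; split=> // t _ /=; rewrite scaler0 subr0; exact: (cone0 hC he).
rewrite inf_out ?sup_out ?subr0// => -[_ [b bP]].
- by have := bP (b + 1) I; lra.
- by have := bP (b - 1) I; lra.
Qed.

Lemma hopf_osc_ge0 x : 0 <= hopf_osc C x e.
Proof.
have [/hopf_osc_unit_eq0 -> //|e0] := eqVneq e 0.
by rewrite hopf_oscE; exact: sublinearN (Mratio_sublinear hC he e0) x.
Qed.

Lemma order_interval0P x : order_interval C 0 e x <-> C x /\ C (e - x).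
Proof. by rewrite /order_interval /cone_le /= subr0. Qed.

(** Both extremal multiples of [e] in the oscillation are attained: if they
coincide, pointedness puts [x] on the line of [e]. *)
Lemma order_interval_osc x : order_interval C 0 e x ->
  hopf_osc C x e <= 1 /\ (hopf_osc C x e = 0 -> exists m : R, x = m *: e).
Proof.
move=> /order_interval0P[Cx Cex].
have [e0|e0] := eqVneq e 0.
  rewrite hopf_osc_unit_eq0//; split=> // _; exists 0.
  by rewrite (unit_eq0 x e0) e0 scaler0.
rewrite hopf_oscE; split.
  have : Mratio C x e <= 1 by apply: (Mratio_le hC he e0); rewrite scale1r.
  have : Mratio C (- x) e <= 0.
    by apply: (Mratio_le hC he e0); rewrite scale0r sub0r opprK.
  lra.
move=> osc0; exists (Mratio C x e).
have h := Mratio_attained hC he e0 x; apply/esym/subr0_eq.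
apply: (cone_pointed hC _ h); rewrite opprB.
have := Mratio_attained hC he e0 (- x).
have -> : Mratio C (- x) e = - Mratio C x e by lra.
by rewrite scaleNr opprK addrC.
Qed.

Lemma rescale_to_interval z : hopf_osc C z e != 0 ->
  exists m : R, exists2 x, order_interval C 0 e x &
    z = hopf_osc C z e *: x + m *: e.
Proof.
have [e0|e0] := eqVneq e 0; first by rewrite hopf_osc_unit_eq0 ?eqxx.
move=> osc0; have osc_gt0 : 0 < hopf_osc C z e.
  by rewrite lt_def osc0 hopf_osc_ge0.
set m := - Mratio C (- z) e.
have oscE : hopf_osc C z e = Mratio C z e - m.
  by rewrite hopf_oscE opprK.
exists m, ((hopf_osc C z e)^-1 *: (z - m *: e)); last first.
  by rewrite scalerA divff// scale1r subrK.
apply/order_interval0P; split.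
  apply: (coneZ hC); first by rewrite invr_ge0 ltW.
  by have := Mratio_attained hC he e0 (- z); rewrite opprK /m scaleNr opprK addrC.
have -> : e - (hopf_osc C z e)^-1 *: (z - m *: e) =
    (hopf_osc C z e)^-1 *: (Mratio C z e *: e - z).
  rewrite -[X in X - _]scale1r -(mulVf osc0) -scalerA -scalerBr; congr (_ *: _).
  by rewrite {1}oscE scalerBl opprB addrA subrK.
apply: (coneZ hC); first by rewrite invr_ge0 ltW.
exact: Mratio_attained hC he e0 z.
Qed.

(** Thompson's norm is an infimum, so a norm at most 1 yields the bounds
[- a e <= z <= a e] only for [a > 1]; attainment of [Mratio] lets [a] tend to
1. *)
Lemma thompson_norm_le1 z :
  thompson_norm C e z <= 1 <-> C (e + z) /\ C (e - z).
Proof.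
rewrite /thompson_norm /cone_le; split; last first.
  move=> [Cp Cm]; apply: ge_inf; first by exists 0 => a [/ltW].
  by split; rewrite ?ltr01// scale1r// opprK addrC.
have [e0|e0] := eqVneq e 0.
  by rewrite (unit_eq0 z e0) addr0 subr0 => _; split; exact: (cone_unit he).
set A := [set a | _] => infA.
have hA : has_inf A.
  split; last by exists 0 => b [/ltW].
  have [k k0 ke] := interior_order_unit hC he.
  exists (k * `|z| + 1); split; first by rewrite ltr_wpDl// mulr_ge0// ltW.
    rewrite opprK addrC scalerDl scale1r addrAC.
    apply: (coneD hC) (cone_unit he).
    by have := ke (- z); rewrite normrN opprK.
  rewrite scalerDl scale1r addrAC.
  exact: (coneD hC) (ke z) (cone_unit he).
have near1 (a : R) : 1 < a -> exists2 b, A b & b < a.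
  move=> a1; have eps0 : 0 < a - inf A by lra.
  have [b Ab ba] := inf_adherent eps0 hA.
  by exists b => //; lra.
have M1 x : (forall b, A b -> C (b *: e - x)) -> C (e - x).
  move=> Ax; have M1 : Mratio C x e <= 1.
    apply/ler_addgt0Pr => eps eps0.
    have [|b Ab ba] := near1 (1 + eps); first lra.
    apply: le_trans (ltW ba); apply: (Mratio_le hC he e0); exact: Ax.
  have := coneD hC _ _ (Mratio_attained hC he e0 x)
    (coneZ hC (1 - Mratio C x e) _ _ (cone_unit he)).
  by rewrite subr_ge0 => /(_ M1); rewrite addrAC -scalerDl
    [Mratio C x e + _]addrC subrK scale1r.
split; last by apply: M1 => b [].
rewrite -[z]opprK; apply: M1 => b [_ + _].
by rewrite opprK addrC opprK.
Qed.

(** For [g] vanishing at [e], the map [x |-> 2 x - e] from the order interval to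
Thompson's unit ball doubles the value of [g]; the ball is symmetric, which
takes care of the absolute value. *)
Lemma half_thompson_dual_norm g : linear g -> g e = 0 ->
  (2^-1%:E * thompson_dual_norm C e g)%E =
  ereal_sup [set (g x)%:E | x in order_interval C 0 e].
Proof.
move=> gl ge0; apply/eqP; rewrite eq_le; apply/andP; split.
  rewrite lee_pdivrMl//; apply: ge_ereal_sup => _ [z /thompson_norm_le1[Cp Cm] <-].
  rewrite -lee_pdivrMl// -EFinM.
  wlog gz : z Cp Cm / 0 <= (g z : R).
    move=> H; have [/H|gz] := leP 0 (g z : R); first exact.
    have := H (- z); rewrite opprK (linear_fctN _ gl) normrN; apply=> //.
    by rewrite oppr_ge0 ltW.
  apply: ereal_sup_ubound; exists (2^-1 *: (e + z)).
    apply/order_interval0P; split; first by apply: (coneZ hC).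
    have -> : e - 2^-1 *: (e + z) = 2^-1 *: (e - z).
      rewrite scalerDr scalerBr opprD addrA; congr (_ - _).
      by rewrite -[X in X - _]scale1r -scalerBl; congr (_ *: _); lra.
    exact: (coneZ hC).
  by rewrite (linear_fctZ _ gl) (linear_fctD _ gl) ge0 add0r ger0_norm.
rewrite lee_pdivlMl//; rewrite -ereal_sup_pZl//.
apply: ge_ereal_sup => _ [_ [x /order_interval0P[Cx Cex] <-] <-].
have gE : g (2 *: x - e) = 2 * g x.
  by rewrite (linear_fctB _ gl) (linear_fctZ _ gl) ge0 subr0.
apply: (@le_trans _ _ (`|g (2 *: x - e)|)%:E).
  by rewrite -EFinM lee_fin gE; exact: ler_norm.
apply: ereal_sup_ubound; exists (2 *: x - e) => //=.
apply/thompson_norm_le1; split; first by rewrite addrC subrK; exact: (coneZ hC).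
have -> : e - (2 *: x - e) = 2 *: (e - x).
  by rewrite opprB addrA scalerBr; congr (_ - _); rewrite scaler_nat mulr2n.
exact: (coneZ hC).
Qed.

End OrderUnitInterval.

(** * Oscillation ratio and disjoint extreme pairs *)

Theorem theorem1p1 (R : realType) (X1 X2 : completeNormedModType R)
    (C1 : set X1) (C2 : set X2) (e1 : X1) (e2 : X2)
    (T : {linear X1 -> X2})
    (hX2 : exists x : X2, x != 0)
    (hC1 : closed_pointed_convex_cone C1) (hN1 : normal_cone C1)
    (hC2 : closed_pointed_convex_cone C2) (hN2 : normal_cone C2)
    (he1 : C1° e1) (he2 : C2° e2)
    (hT : bounded_near T (nbhs (0 : X1)))
    (hTe : exists c : R, T e1 = c *: e2) :
  let osc_ratio : \bar R :=
    sup_or0 [set (hopf_osc C2 (T z) e2 / hopf_osc C1 z e1)%:E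
            | z in [set z | hopf_osc C1 z e1 <> 0]] in
  let pairs : set ((X2 -> R^o) * (X2 -> R^o)) :=
    [set p | [/\ extr (normalized C2 e2) p.1, extr (normalized C2 e2) p.2
               & disjoint_functionals C2 e2 p.1 p.2]] in
  let dual_diameter : \bar R :=
    ereal_sup [set thompson_dual_norm C1 e1 (adjoint T p.1 - adjoint T p.2)
              | p in pairs] in
  let interval_sup : \bar R :=
    ereal_sup [set ereal_sup [set ((p.1 - p.2) (T x))%:E
                             | x in order_interval C1 0 e1]
              | p in pairs] in
  osc_ratio = (2^-1%:E * dual_diameter)%E /\
  (2^-1%:E * dual_diameter)%E = interval_sup.
Proof.
move=> osc_ratio pairs dual_diameter interval_sup.
have [x2 /(unit_neq0 hC2 he2) e2_neq0] := hX2.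
have [c Te1] := hTe.
have attained y : exists2 p, pairs p & (p.1 - p.2) y = hopf_osc C2 y e2.
  have [nu [pi [hnu hpi hdisj oscE]]] := hopf_osc_attained hC2 he2 e2_neq0 y.
  by exists (nu, pi).
have pullback p : pairs p -> linear (adjoint T p.1 - adjoint T p.2) /\
    (adjoint T p.1 - adjoint T p.2) e1 = 0.
  move=> [[[[[l1 _] _] n1] _] [[[[l2 _] _] n2] _] _]; split.
    move=> a x y; rewrite /adjoint !fctE /= linearP l1 l2 scalerBr opprD.
    by rewrite addrACA.
  rewrite /adjoint !fctE /= Te1 (linear_fctZ _ l1) (linear_fctZ _ l2) n1 n2.
  exact: subrr.
have dual_eq : (2^-1%:E * dual_diameter)%E = interval_sup.
  rewrite /dual_diameter -ereal_sup_pZl// image_comp; congr ereal_sup.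
  apply: eq_imagel => p /pullback[gl ge] /=.
  by rewrite (half_thompson_dual_norm hC1 he1).
rewrite dual_eq; split=> //.
have osc_bound p x : pairs p -> order_interval C1 0 e1 x ->
    (((p.1 - p.2) (T x))%:E <= interval_sup)%E.
  move=> pp hx; apply: (@le_trans _ _ (ereal_sup
    [set ((p.1 - p.2) (T x))%:E | x in order_interval C1 0 e1])).
    by apply: ereal_sup_ubound; exists x.
  by apply: ereal_sup_ubound; exists p.
have interval0 : order_interval C1 0 e1 0.
  apply/order_interval0P; rewrite subr0.
  by split; [exact: cone0 hC1 he1 | exact: cone_unit he1].
apply/eqP; rewrite eq_le; apply/andP; split.
  rewrite /osc_ratio /sup_or0; case: asboolP => _; last first.
    have [p pp _] := attained 0; have := osc_bound p 0 pp interval0.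
    by rewrite (linear_fct0 _ (pullback p pp).1 : (p.1 - p.2) (T 0) = 0).
  apply: ge_ereal_sup => _ [z /eqP oscz <-].
  have [p pp pE] := attained (T z); have [gl ge] := pullback p pp.
  have [m [x hx zE]] := rescale_to_interval hC1 he1 z oscz.
  apply: le_trans (osc_bound p x pp hx); rewrite lee_fin -pE.
  change ((adjoint T p.1 - adjoint T p.2) z / hopf_osc C1 z e1 <=
    (adjoint T p.1 - adjoint T p.2) x).
  rewrite {1}zE (linear_fctD _ gl) !(linear_fctZ _ gl) ge mulr0 addr0.
  by rewrite mulrAC divff// mul1r.
have osc_ratio_ub z : hopf_osc C1 z e1 <> 0 ->
    ((hopf_osc C2 (T z) e2 / hopf_osc C1 z e1)%:E <= osc_ratio)%E.
  move=> oscz; rewrite /osc_ratio /sup_or0; case: asboolP => [_|[]].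
    by apply: ereal_sup_ubound; exists z.
  by exists (hopf_osc C2 (T z) e2 / hopf_osc C1 z e1)%:E; exists z.
have osc_ratio_ge0 : (0 <= osc_ratio)%E.
  have [[z oscz]|noz] := pselect (exists z, hopf_osc C1 z e1 <> 0).
    apply: le_trans (osc_ratio_ub z oscz).
    by rewrite lee_fin divr_ge0// hopf_osc_ge0.
  rewrite /osc_ratio /sup_or0; case: asboolP => // -[_ [z oscz _]].
  by case: noz; exists z.
apply: ge_ereal_sup => _ [p pp <-]; apply: ge_ereal_sup => _ [x hx <-].
have [gl ge] := pullback p pp.
have [osc1 osc0] := order_interval_osc hC1 he1 x hx.
have [h|/eqP oscx] := eqVneq (hopf_osc C1 x e1) 0.
  have [m xE] := osc0 h.
  change (((adjoint T p.1 - adjoint T p.2) x)%:E <= osc_ratio)%E.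
  by rewrite xE (linear_fctZ _ gl) ge mulr0.
apply: le_trans (osc_ratio_ub x oscx); rewrite lee_fin.
have [[h1 _] [h2 _] _] := pp.
apply: (le_trans (normalized_diff_le_osc hC2 he2 e2_neq0 _ _ (T x) h1 h2)).
have oscx_gt0 : 0 < hopf_osc C1 x e1.
  by rewrite lt_def hopf_osc_ge0// andbT; apply/eqP.
rewrite ler_pdivlMr// ler_piMr//; exact: hopf_osc_ge0.
Qed.
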